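(* Let $G$ be a connected plane bipartite graph on $s$ vertices with directed planar dual $G^*$. Then the $h$-vector $h(x)$ of any triangulation of the root polytope $Q_G$ and the parking function enumerator $p(u)$ of $G^*$ (with respect to any root) satisfy $$u^{s-1}\,h(u^{-1})=p(u).$$
   Context: All graphs are finite; multiple edges are allowed. A plane graph is a graph embedded in the plane, equivalently in the oriented sphere $S^2$. Let $E,V$ be the color classes of $G$. Dual graph: the vertex set of $G^*$ is the set $R$ of regions of $G$ (components of $S^2\setminus G$), and $G^*$ has one edge crossing each edge of $G$, directed so that, traversing it, one has the endpoint in $E$ of the crossed edge of $G$ on the right and the endpoint in $V$ on the left. Root polytope: with $\mathbf e,\mathbf v$ ($e\in E$, $v\in V$) the standard generators of $\mathbf R^E\oplus\mathbf R^V$, $Q_G=\operatorname{Conv}\{\mathbf e+\mathbf v\mid ev\text{ is an edge of }G\}$, of dimension $d=s-2$. A triangulation of $Q_G$ is a collection of maximal ($d$-dimensional) simplices, with vertices among the vertices of $Q_G$, whose union is $Q_G$ and any two of which intersect in a common face. $h$-vector: for a $d$-dimensional simplicial complex with $f_k$ simplices of dimension $k$ ($k\ge0$), put $f(y)=y^{d+1}+f_0y^d+f_1y^{d-1}+\cdots+f_{d-1}y+f_d$ and $h(x)=f(x-1)$. Parking functions: let $J$ be a directed graph with vertex set $R$ and root $r_0\in R$. For non-empty $R'\subset R\setminus\{r_0\}$ and $r\in R'$, let $\deg_{R'}(r)$ be the number of edges with endpoint (head) $r$ and startpoint (tail) outside of $R'$. A function $\pi\colon R\setminus\{r_0\}\to\mathbf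 N=\{0,1,2,\ldots\}$ is a parking function of $J$ with respect to $r_0$ if every non-empty $R'\subset R\setminus\{r_0\}$ contains a vertex $r$ with $\pi(r)<\deg_{R'}(r)$. With $\Pi$ the set of parking functions, the parking function enumerator is $p(u)=\sum_{\pi\in\Pi}u^{\sum_{r\in R\setminus\{r_0\}}\pi(r)}$. *)

(* Defs.v *)
From HB Require Import structures.
From mathcomp Require Import all_boot all_order all_algebra all_fingroup.
From mathcomp Require Import finmap.
From mathcomp Require Import mathcomp_extra boolp classical_sets functions.
From mathcomp Require Import cardinality fsbigop reals.

Set Implicit Arguments.
Unset Strict Implicit.
Unset Printing Implicit Defensive.

Import Order.TTheory GRing.Theory Num.Theory.

Local Open Scope ring_scope.

(* The two vertex classes are [Eside] and [Vside]; multiple edges are allowed,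
   since [edge] is an arbitrary finite type. *)
Record bigraph := Bigraph {
  Eside : finType;
  Vside : finType;
  edge : finType;
  eend : edge -> Eside;
  vend : edge -> Vside }.

Definition nb_vertices (G : bigraph) : nat := (#|Eside G| + #|Vside G|)%N.

Definition adjacent (G : bigraph) : rel (Eside G + Vside G) := fun x y =>
  match x, y with
  | inl e, inr v | inr v, inl e => [exists a : edge G, (eend a == e) && (vend a == v)]
  | _, _ => false
  end.

Definition bigraph_connected (G : bigraph) : Prop :=
  (0 < nb_vertices G)%N /\ forall x y, connect (@adjacent G) x y.

(* An embedding of a connected graph in an oriented closed surface is recorded,
   up to orientation-preserving homeomorphism, by its rotation system: the
   cyclic order in which the edges leave each vertex. [rotE a] (resp. [rotV a])
   is the edge following [a] counterclockwise around its endpoint in [Eside]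
   (resp. [Vside]). *)
Record rotation_system (G : bigraph) := RotationSystem {
  rotE : {perm edge G};
  rotV : {perm edge G};
  rotEP : forall a b, (b \in porbit rotE a) = (eend b == eend a);
  rotVP : forall a b, (b \in porbit rotV a) = (vend b == vend a) }.

(* [(a, true)] is the edge [a] traversed from its [Eside] end to its [Vside]
   end, and [(a, false)] is [a] traversed in the opposite direction. *)
Definition dart (G : bigraph) : finType := (edge G * bool)%type.

Section Regions.
Variables (G : bigraph) (M : rotation_system G).

(* Walking along the boundary of a region with the region on the left: having
   arrived at a vertex along an edge, leave it along the next edge in clockwise
   order. *)
Definition face_next (x : dart G) : dart G :=
  if x.2 then ((rotV M)^-1%g x.1, false) else ((rotE M)^-1%g x.1, true).

Definition face_walk (x : dart G) : {set dart G} :=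
  [set y | fconnect face_next x y].

(* A region is represented by the set of darts having it on their left. A
   connected graph without edges is a single vertex, whose complement is one
   region without boundary darts. *)
Definition region_set : {set {set dart G}} :=
  if #|edge G| == 0%N then [set finset.set0] else [set face_walk x | x : dart G].

Definition region : finType := {A : {set dart G} | A \in region_set}.

Fact face_walk_in (x : dart G) : face_walk x \in region_set.
Proof.
rewrite /region_set ifN; first exact: imset_f.
by rewrite -lt0n; apply/card_gt0P; exists x.1.
Qed.

Definition left_region (x : dart G) : region := exist _ (face_walk x) (face_walk_in x).

(* For connected [G], Euler's formula says that the surface is the sphere. *)
Definition spherical : Prop := (nb_vertices G + #|region| = #|edge G| + 2)%N.

End Regions.

Fact face_next_inj (G : bigraph) (M : rotation_system G) :
  injective (face_next M).
Proof. by case=> a [] [b []] //= [] /perm_inj ->. Qed.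

Record digraph := Digraph {
  vertex : finType;
  arc : finType;
  tail : arc -> vertex;
  head : arc -> vertex }.

(* The dual arc crosses [a] from the region on the left to the region on the
   right of [a] traversed from its [Eside] end to its [Vside] end: it then has
   the [Eside] end of [a] on its right and the [Vside] end on its left. *)
Definition dual (G : bigraph) (M : rotation_system G) : digraph :=
  @Digraph (region M) (edge G)
    (fun a => left_region M (a, true)) (fun a => left_region M (a, false)).

Section Parking.
Variables (J : digraph) (r0 : vertex J).

Definition nonroot : finType := {r : vertex J | r != r0}.

Definition indeg_from_outside (R' : {set nonroot}) (r : nonroot) : nat :=
  #|[set a : arc J | (head a == val r) && (tail a \notin [set val t | t in R'])]|.

Definition parking_function (p : {ffun nonroot -> nat}) : Prop :=
  forall R' : {set nonroot}, R' != finset.set0 ->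
    exists2 r, r \in R' & (p r < indeg_from_outside R' r)%N.

Definition parking_functions : set {ffun nonroot -> nat} :=
  [set p | parking_function p]%classic.

(* A [\sum_(_ \in _)] has its intended meaning only when its support is finite;
   [finite_parking_functions] below shows that this is the case. *)
Definition parking_weight (p : {ffun nonroot -> nat}) : nat :=
  (\sum_(r : nonroot) p r)%N.

Definition parking_enumerator : {poly int} :=
  \sum_(p \in parking_functions) ('X^(parking_weight p) : {poly int}).

Lemma finite_parking_functions : finite_set parking_functions.
Proof.
pose B := #|arc J|.+1.
apply: (@sub_finite_set _ _
  [set [ffun r => nat_of_ord (q r)] | q in [set: {ffun nonroot -> 'I_B}]]%classic).
  move=> p Pp /=; exists [ffun r => inord (p r) : 'I_B] => //.
  apply/ffunP=> r; rewrite !ffunE inordK //.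
  have [|r' /set1P -> lt_pr] := Pp [set r].
  - by apply/set0Pn; exists r; rewrite set11.
  - exact: leq_trans lt_pr (leq_trans (max_card _) (leqnSn _)).
apply: finite_image; exact: finite_finset.
Qed.

End Parking.

Section Polytopes.
Variables (R : realType) (W : lmodType R).

Local Open Scope classical_set_scope.

Definition hull (S : {fset W}) : set W :=
  [set x | exists w : W -> R, [/\ forall p, p \in S -> 0 <= w p,
     \sum_(p <- S) w p = 1 & x = \sum_(p <- S) w p *: p]].

Definition affinely_independent (S : {fset W}) : Prop :=
  forall w : W -> R, \sum_(p <- S) w p = 0 -> \sum_(p <- S) w p *: p = 0 ->
    forall p, p \in S -> w p = 0.

Definition vertex_of (Q : set W) (x : W) : Prop :=
  Q x /\ forall (t : R) (y z : W), 0 < t < 1 -> Q y -> Q z ->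
    x = t *: y + (1 - t) *: z -> y = x /\ z = x.

(* A simplex is represented by its set of vertices. The parameter [n] is the
   number [d + 1] of vertices of a [d]-dimensional simplex; stating everything
   with [n] rather than [d] accommodates [d = -1], which occurs for the empty
   root polytope of the one-vertex graph. *)
Definition triangulation (Q : set W) (n : nat) (T : {fset {fset W}}) : Prop :=
  [/\ forall S, S \in T -> [/\ forall p, p \in S -> vertex_of Q p,
                               affinely_independent S & #|` S| = n],
      forall x, Q x <-> exists2 S, S \in T & hull S x
    & forall S1 S2, S1 \in T -> S2 \in T ->
        exists F : {fset W}, [/\ (F `<=` S1)%fset, (F `<=` S2)%fset
                               & hull S1 `&` hull S2 = hull F]].

Definition simplices (T : {fset {fset W}}) : {fset {fset W}} :=
  (\bigcup_(S <- T) fpowerset S)%fset.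

Definition nb_simplices (T : {fset {fset W}}) (k : nat) : nat :=
  #|` [fset F in simplices T | #|` F| == k.+1]%fset|.

(* For a complex of dimension [d = n - 1]. *)
Definition f_poly (n : nat) (T : {fset {fset W}}) : {poly int} :=
  'X^n + \sum_(k < n) (nb_simplices T k)%:R *: 'X^(n - k.+1).

Definition h_poly (n : nat) (T : {fset {fset W}}) : {poly int} :=
  f_poly n T \Po ('X - 1).

End Polytopes.

Section RootPolytope.
Variables (R : realType) (G : bigraph).

Definition ambient : lmodType R :=
  ({ffun Eside G -> R^o} * {ffun Vside G -> R^o})%type.

(* The point [e + v] of an edge with ends [e] and [v]. *)
Definition edge_point (a : edge G) : ambient :=
  ([ffun e => (e == eend a)%:R], [ffun v => (v == vend a)%:R]).

Definition root_polytope : set ambient :=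
  hull [fset edge_point a | a in edge G]%fset.

(* The dimension of the root polytope of a connected [G] is
   [nb_vertices G - 2]. *)
Definition root_triangulation (T : {fset {fset ambient}}) : Prop :=
  triangulation root_polytope (nb_vertices G).-1 T.

End RootPolytope.

(* Main.v *)
(* Write [x ~ y] when the edge multiplicities [x, y : edge G -> nat] have the same
   vertex sums, and call a family of edge sets transversal when every class of
   [~] has exactly one member whose support lies in the family. Counting classes
   by degree shows that two transversal families have equally many [j]-element
   sets for every [j].

   The faces of a triangulation of the root polytope form a transversal family:
   uniqueness holds because simplices meet in common faces, and existence because
   linearly independent edge points are unimodular.

   The complements of the arc sets of the dual through which every region can be
   reached from [r0] form another one: by planarity [x ~ y] iff [y - x] is the
   coboundary of an integral potential on the regions, and the member of a class
   with the smallest potential vanishing at [r0] is the one from which no set of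
   regions avoiding [r0] can be fired.

   Hence the h-polynomial is a sum over root-connected arc sets of the dual, and
   deletion-contraction at an arc leaving the root turns that sum into the parking
   function enumerator, for any digraph. *)

Require Import Defs.
From mathcomp Require Import all_boot all_order all_algebra all_fingroup.
From mathcomp Require Import finmap.
From mathcomp Require Import classical_sets reals.
From mathcomp Require Import boolp functions cardinality fsbigop.
From mathcomp Require Import zify ring.

Set Implicit Arguments.
Unset Strict Implicit.
Unset Printing Implicit Defensive.

Import Order.TTheory GRing.Theory Num.Theory.
Local Open Scope ring_scope.

(** * Parking functions and root-connected arc sets *)

Section DeletionContraction.
Variables (V A : finType) (tl hd : A -> V).
Implicit Types (K D : {set V}) (B Z : {set A}) (q : {ffun V -> nat}).

(** Cut form of reachability: every vertex can be reached from [K] along arcs of [Z]. It matches the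
    subset condition in the definition of parking functions. *)
Definition root_spanning K Z : bool :=
  [forall D : {set V}, (D != finset.set0) && [disjoint D & K] ==>
    [exists a in Z, (hd a \in D) && (tl a \notin D)]].

Lemma root_spanningP K Z :
  reflect (forall D, D != finset.set0 -> [disjoint D & K] ->
             exists a, [/\ a \in Z, hd a \in D & tl a \notin D])
          (root_spanning K Z).
Proof.
apply: (iffP forallP) => [H D D0 dD|H D].
  have /existsP[a /and3P[]] := implyP (H D) (introT andP (conj D0 dD)).
  by exists a.
apply/implyP => /andP[D0 dD]; have [a [? ? ?]] := H D D0 dD.
by apply/existsP; exists a; apply/and3P.
Qed.

Definition arcs_into B D (r : V) : {set A} :=
  [set a in B | (hd a == r) && (tl a \notin D)].

(* Parking functions of the graph in which [K] is merged into a single root. *)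
Definition set_parking K B : set {ffun V -> nat} :=
  [set q : {ffun V -> nat} | (forall r, r \in K -> q r = 0%N) /\
    forall D, D != finset.set0 -> [disjoint D & K]%bool ->
      exists2 r, r \in D & (q r < #|arcs_into B D r|)%N]%classic.

Lemma disjoint_setU1 (D K : {set V}) r :
  [disjoint D & r |: K] = (r \notin D) && [disjoint D & K].
Proof.
rewrite disjoint_sym (@eq_disjoint _ _ [predU1 r & K]) => [|x]; last by rewrite !inE.
by rewrite disjointU1 [[disjoint K & D]%bool]disjoint_sym.
Qed.

(** A set [D] containing [hd a] is entered by [a] itself, and a set missing [hd a] is never entered
    by [a]. *)
Lemma root_spanning_contract K Z a : a \in Z -> tl a \in K -> hd a \notin K ->
  root_spanning K Z = root_spanning (hd a |: K) (Z :\ a).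
Proof.
move=> aZ tK hK; apply/root_spanningP/root_spanningP => H D D0.
  rewrite disjoint_setU1 => /andP[hD dD].
  have [b [bZ bD tD]] := H D D0 dD; exists b; split=> //.
  by rewrite !inE bZ andbT; apply: contraNneq hD => <-.
move=> dD; have [hD|hD] := boolP (hd a \in D).
  by exists a; rewrite aZ hD (disjointFl dD).
have [|b [bZ bD tD]] := H D D0; first by rewrite disjoint_setU1 hD.
by exists b; move: bZ; rewrite !inE => /andP[].
Qed.

Lemma arcs_into_delete B D a r : hd a != r ->
  arcs_into (B :\ a) D r = arcs_into B D r.
Proof.
move=> ha; apply/setP => b; rewrite !inE.
by have [->|] := eqVneq b a; rewrite ?(negPf ha) ?andbF.
Qed.

Lemma card_arcs_into_delete B D a : a \in B -> tl a \notin D ->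
  #|arcs_into B D (hd a)| = #|arcs_into (B :\ a) D (hd a)|.+1.
Proof.
move=> aB tD; rewrite (cardsD1 a) !inE aB eqxx tD /= add1n; congr _.+1.
by apply: eq_card => b; rewrite !inE -!andbA.
Qed.

(** If [q] vanishes at [hd a], any [D] containing [hd a] meets the condition there, because [a] is
    counted. For the other sets, deleting [a] changes no relevant count. *)
Lemma set_parking_contract K B a : a \in B -> tl a \in K -> hd a \notin K ->
  (set_parking K B `&` [set q : {ffun V -> nat} | q (hd a) = 0%N] =
   set_parking (hd a |: K) (B :\ a))%classic.
Proof.
move=> aB tK hK; apply/seteqP; split=> q /=.
  move=> [[q0 H] qa]; split=> [r|D D0].
    by rewrite !inE => /orP[/eqP->|/q0].
  rewrite disjoint_setU1 => /andP[hD dD]; have [r rD qr] := H D D0 dD.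
  by exists r => //; rewrite arcs_into_delete //; apply: contraNneq hD => ->.
move=> [q0 H]; have qa : q (hd a) = 0%N by apply: q0; rewrite !inE eqxx.
split=> //; split=> [r rK|D D0 dD]; first by apply: q0; rewrite !inE rK orbT.
have [hD|hD] := boolP (hd a \in D).
  exists (hd a) => //; rewrite qa card_gt0; apply/set0Pn; exists a.
  by rewrite !inE aB eqxx (disjointFl dD).
have [|r rD qr] := H D D0; first by rewrite disjoint_setU1 hD.
by exists r => //; rewrite -(@arcs_into_delete _ _ a) //; apply: contraNneq hD => ->.
Qed.

Definition incr_at (r : V) q : {ffun V -> nat} := [ffun x => ((x == r) + q x)%N].

Lemma incr_at_inj r : injective (incr_at r).
Proof.
by move=> q q' /ffunP E; apply/ffunP => x; have := E x; rewrite !ffunE => /addnI.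
Qed.

(** The tail of [a] lies outside every admissible [D], so [a] adds exactly one to each count at
    [hd a]. Raising [q] there by one compensates. *)
Lemma set_parking_delete K B a : a \in B -> tl a \in K -> hd a \notin K ->
  set_bij (set_parking K (B :\ a))
    (set_parking K B `&` ~` [set q : {ffun V -> nat} | q (hd a) = 0%N])%classic (incr_at (hd a)).
Proof.
move=> aB tK hK.
have inK r : r \in K -> (r == hd a) = false.
  by move=> rK; apply: contraNF hK => /eqP <-.
have incr_lt q D r : [disjoint D & K] ->
    (incr_at (hd a) q r < #|arcs_into B D r|)%N
    = (q r < #|arcs_into (B :\ a) D r|)%N.
  move=> dD; rewrite ffunE; have [->|ra] := eqVneq r (hd a).
    by rewrite card_arcs_into_delete ?(disjointFl dD).
  by rewrite arcs_into_delete // eq_sym.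
split.
- move=> q [q0 H]; split; last by rewrite /= ffunE eqxx.
  split=> [r rK|D D0 dD]; first by rewrite ffunE inK // q0.
  by have [r rD qr] := H D D0 dD; exists r; rewrite ?incr_lt.
- by move=> q q' _ _ /incr_at_inj.
- move=> q [[q0 H]] /= /eqP; rewrite -lt0n => qa.
  (* The truncated subtraction is exact because [q (hd a)] is positive. *)
  have Eq : incr_at (hd a) [ffun x => (q x - (x == hd a))%N] = q.
    apply/ffunP=> x; rewrite !ffunE subnKC //.
    by have [->|] := eqVneq x (hd a).
  exists [ffun x => (q x - (x == hd a))%N] => //; split=> [r rK|D D0 dD].
    by rewrite ffunE inK // subn0 q0.
  by have [r rD qr] := H D D0 dD; exists r; rewrite // -incr_lt // Eq.
Qed.

Lemma finite_set_parking K B : finite_set (set_parking K B).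
Proof.
apply: (@sub_finite_set _ _
  [set [ffun r => nat_of_ord (q r)] | q in [set: {ffun V -> 'I_#|A|.+1}]]%classic);
  last by apply: finite_image; exact: finite_finset.
move=> q [q0 H] /=; exists [ffun r => inord (q r)] => //.
apply/ffunP=> r; rewrite !ffunE inordK //.
have [/q0 -> //|rK] := boolP (r \in K).
have [||r' /set1P -> lt_q] := H [set r]; last exact: leq_trans lt_q (leqW (max_card _)).
  by apply/set0Pn; exists r; rewrite set11.
by rewrite disjoints1.
Qed.

Definition parking_sum K B : {poly int} :=
  \sum_(q \in set_parking K B) ('X^(\sum_r q r)%N : {poly int}).

(** A root-spanning [Z] has at least one arc into each vertex outside [K], so the last exponent is
    the excess of [Z] over a spanning forest rooted at [K]. *)
Definition spanning_sum K B : {poly int} :=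
  \sum_(Z : {set A} | (Z \subset B) && root_spanning K Z)
    'X^(#|B| - #|Z|) * (1 - 'X) ^+ (#|Z| - (#|V| - #|K|)).

(** Split by whether [q (hd a)] is zero. The non-zero case is the deletion with one value raised by
    one, whence the factor ['X]. *)
Lemma parking_sum_rec K B a : a \in B -> tl a \in K -> hd a \notin K ->
  parking_sum K B = 'X * parking_sum K (B :\ a) + parking_sum (hd a |: K) (B :\ a).
Proof.
move=> aB tK hK; rewrite {1}/parking_sum.
rewrite (fsbigID [set q : {ffun V -> nat} | q (hd a) = 0%N]%classic) /=;
  last exact: finite_set_parking.
rewrite set_parking_contract // addrC; congr (_ + _).
rewrite (reindex_fsbig _ _ _ _ (set_parking_delete aB tK hK)) mulr_fsumr.
apply: eq_fsbigr => q _; rewrite -exprS; congr ('X^_).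
rewrite (eq_bigr (fun r => (r == hd a) + q r)%N) => [|r _]; last by rewrite ffunE.
rewrite big_split /= (bigD1 (hd a)) //= eqxx big1 // => r /negPf -> //.
Qed.

(** Split by whether [a] is in [Z]. If not, deleting [a] lowers only [#|B|], which gives ['X]. If
    so, contraction lowers [#|B|], [#|Z|] and the number of non-root vertices by one each, and both
    exponents survive. *)
Lemma spanning_sum_rec K B a : a \in B -> tl a \in K -> hd a \notin K ->
  spanning_sum K B = 'X * spanning_sum K (B :\ a) + spanning_sum (hd a |: K) (B :\ a).
Proof.
move=> aB tK hK; rewrite {1}/spanning_sum.
have cB : #|B| = #|B :\ a|.+1 by rewrite (cardsD1 a) aB.
rewrite (bigID (fun Z : {set A} => a \in Z)) /= addrC; congr (_ + _).
  rewrite big_distrr /=; apply: eq_big => [Z|Z].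
    by rewrite finset.subsetD1 andbAC.
  move=> /andP[/andP[ZB _] aZ]; rewrite mulrA -exprS cB subSn //.
  by apply: subset_leq_card; rewrite finset.subsetD1 ZB.
rewrite (reindex_onto (fun Z => a |: Z) (fun Z => Z :\ a)) /=; last first.
  by move=> Z /andP[_ aZ]; rewrite finset.setD1K.
apply: eq_big => Z.
  have [aZ|aZ] := boolP (a \in Z).
    rewrite finset.subsetD1 aZ /= andbF /=; apply/negP => /andP[_ /eqP E].
    by move: aZ; rewrite -E !inE eqxx.
  rewrite setU1K // eqxx andbT setU11 andbT.
  rewrite (@root_spanning_contract _ _ a) ?setU11 // setU1K //.
  by rewrite finset.subUset finset.sub1set aB finset.subsetD1 aZ andbT.
move=> /andP[/andP[/andP[ZB _] _] /eqP E].
have aZ : a \notin Z by rewrite -E !inE eqxx.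
rewrite cardsU1 aZ cB cardsU1 hK /= !add1n subSS.
have lt : (#|K| < #|V|)%N.
  by rewrite -cardsT; apply: proper_card; apply/properP; split;
    [exact: finset.subsetT|exists (hd a)].
by rewrite -(subnSK lt) subSS.
Qed.

Lemma sum_subsets_binomial B :
  \sum_(Z : {set A} | Z \subset B) 'X^(#|B| - #|Z|) * (1 - 'X) ^+ #|Z|
  = 1 :> {poly int}.
Proof.
rewrite -[RHS](expr1n _ #|B|) -[X in X ^+ _](subrKC 'X 1) exprDn.
rewrite (partition_big (fun Z => inord #|Z| : 'I_#|B|.+1) xpredT) //=.
apply: eq_bigr => k _.
rewrite (eq_bigl (fun Z => Z \in [set Z : {set A} | (Z \subset B) && (#|Z| == k)])).
  rewrite (eq_bigr (fun=> 'X^(#|B| - k) * (1 - 'X) ^+ k)) => [|Z]; last first.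
    by rewrite inE => /andP[_ /eqP ->].
  by rewrite sumr_const cards_draws.
move=> Z; rewrite inE; apply: andb_id2l => ZB.
by rewrite -val_eqE /= inordK // ltnS subset_leq_card.
Qed.

(** Induction on [#|B|], as both sides obey the same recursion. If no arc leaves [K], then either
    [K] is everything and both sums are 1, or nothing enters the complement of [K] and both sums are
    empty. *)
Lemma parking_sum_spanning K B : parking_sum K B = spanning_sum K B.
Proof.
have [n] := ubnP #|B|; elim: n K B => // n IH K B ltB.
have [/existsP[a /and3P[aB tK hK]]|] :=
    boolP [exists a in B, (tl a \in K) && (hd a \notin K)].
  have ltBa : (#|B :\ a| < n)%N by move: ltB; rewrite (cardsD1 a) aB.
  by rewrite (parking_sum_rec aB) // (spanning_sum_rec aB) // !IH.
move=> /existsPn noarc.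
have [->|KT] := eqVneq K finset.setT.
  have D0 D : [disjoint D & [set: V]] -> D = finset.set0.
    by rewrite finset.disjoints_subset finset.setCT finset.subset0 => /eqP.
  transitivity (1 : {poly int}).
    rewrite /parking_sum (_ : set_parking _ _ = [set [ffun=> 0%N]]%classic).
      rewrite fsbig_set1 big1 ?expr0 // => r _; by rewrite ffunE.
    apply/seteqP; split=> q /=.
      by move=> [q0 _]; apply/ffunP => r; rewrite ffunE q0 ?inE.
    move=> ->; split=> [r _|D D1 /D0 E]; first by rewrite ffunE.
    by rewrite E eqxx in D1.
  rewrite -(sum_subsets_binomial B); apply: eq_big => [Z|Z _].
    rewrite (introT (root_spanningP _ _)) ?andbT // => D D1 /D0 E.
    by rewrite E eqxx in D1.
  by rewrite cardsT subnn subn0.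
have KC0 : ~: K != finset.set0.
  by apply: contra_neq KT => E; rewrite -[K]finset.setCK E finset.setC0.
have KCd : [disjoint ~: K & K] by rewrite finset.disjoints_subset.
rewrite /parking_sum /spanning_sum fsbig1 => [|q [_ H]].
  rewrite big_pred0 // => Z; apply/negP => /andP[/fintype.subsetP ZB].
  move=> /root_spanningP H; have [b [/ZB bB hb tb]] := H _ KC0 KCd.
  by move: (noarc b) hb tb; rewrite !inE bB negbK /= => /nandP[/negP//|/negPn ->].
have [r rK] := H _ KC0 KCd; have -> : arcs_into B (~: K) r = finset.set0; last by rewrite cards0.
apply/setP => b; rewrite !inE; apply/negP => /and3P[bB /eqP hb]; rewrite negbK => tb.
by have /negP[] := noarc b; rewrite bB tb hb -finset.in_setC.
Qed.

End DeletionContraction.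

(** Functions on the non-root vertices are extended by 0 at the root, which leaves the weight
    unchanged. *)
Lemma parking_enumerator_spanning (J : digraph) (r0 : vertex J) :
  parking_enumerator r0 = spanning_sum (@tail J) (@Defs.head J) [set r0] [set: Defs.arc J].
Proof.
rewrite -parking_sum_spanning /parking_sum /parking_enumerator.
pose restrict (q : {ffun vertex J -> nat}) : {ffun nonroot r0 -> nat} :=
  [ffun r => q (val r)].
pose extend (p : {ffun nonroot r0 -> nat}) : {ffun vertex J -> nat} :=
  [ffun r => oapp p 0%N (insub r)].
have degE (D : {set vertex J}) (D' : {set nonroot r0}) r :
    D = [set val t | t in D'] ->
  #|arcs_into (@tail J) (@Defs.head J) [set: Defs.arc J] D (val r)| = indeg_from_outside D' r.
  by move=> ->; apply: eq_card => a; rewrite !inE.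
have valD (D : {set vertex J}) : [disjoint D & [set r0]] ->
    D = [set val t | t in [set t : nonroot r0 | val t \in D]].
  rewrite disjoint_sym disjoints1 => r0D; apply/setP => r.
  apply/idP/imsetP => [rD|[t]]; last by rewrite inE => tD ->.
  have rr0 : r != r0 by apply: contraNneq r0D => <-.
  by exists (exist _ r rr0); rewrite ?inE.
have bij : set_bij (set_parking (@tail J) (@Defs.head J) [set r0] [set: Defs.arc J])
    (@parking_functions J r0) restrict.
  split.
  - move=> q [q0 H] D' /set0Pn[t0 t0D].
    have [||r rD lt] := H [set val t | t in D'].
    + by apply/set0Pn; exists (val t0); apply: imset_f.
    + rewrite disjoint_sym disjoints1; apply/imsetP => -[t _ E].
      by have := valP t; rewrite -E eqxx.
    + case/imsetP: rD lt => t tD -> lt; exists t => //.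
      by rewrite ffunE -(degE _ _ _ erefl).
  - move=> q q'; rewrite !inE => -[q0 _] [q0' _] /ffunP E; apply/ffunP => r.
    have [->|rr0] := eqVneq r r0; first by rewrite q0 ?q0' ?inE.
    by have := E (exist _ r rr0); rewrite !ffunE.
  - move=> p Pp; exists (extend p); last first.
      by apply/ffunP => r; rewrite !ffunE valK.
    split=> [r|D D0 dD]; first by rewrite inE => /eqP ->; rewrite ffunE insubF ?eqxx.
    have [|t] := Pp [set t : nonroot r0 | val t \in D].
      by apply: contra_neq D0 => E; rewrite (valD _ dD) E imset0.
    rewrite inE => tD lt; exists (val t) => //.
    by rewrite ffunE valK /= (degE _ _ _ (valD _ dD)).
rewrite (reindex_fsbig _ _ _ _ bij); apply: eq_fsbigr => q; rewrite inE => -[q0 _].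
congr ('X^_); rewrite /parking_weight.
rewrite [RHS](bigD1 r0) //= q0 ?inE // add0n [RHS](@reindex_omap _ _ _ _ (nonroot r0) val insub).
  apply: eq_big => [t|t _]; first by rewrite (valP t) valK eqxx.
  by rewrite ffunE.
by move=> r rr0; rewrite insubT.
Qed.

(** * Transversal families *)

Section Transversals.
Variables (I : finType) (sim : {ffun I -> nat} -> {ffun I -> nat} -> Prop).
Hypotheses (sim_sym : forall x y, sim x y -> sim y x)
  (sim_trans : forall y x z, sim x y -> sim y z -> sim x z)
  (sim_sum : forall x y, sim x y -> (\sum_i x i = \sum_i y i)%N).

Definition supp (x : {ffun I -> nat}) : {set I} := [set i | x i != 0%N].

Definition transversal (FF : {set {set I}}) : Prop :=
  (forall x, exists2 y, supp y \in FF & sim x y) /\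
  (forall x y, supp x \in FF -> supp y \in FF -> sim x y -> x = y).

Let nat_of_ffun k (f : {ffun I -> 'I_k.+1}) : {ffun I -> nat} :=
  [ffun i => nat_of_ord (f i)].

Let nat_of_ffun_inj k : injective (@nat_of_ffun k).
Proof.
by move=> f g /ffunP E; apply/ffunP => i; apply: val_inj; have := E i; rewrite !ffunE.
Qed.

(** A multiplicity function of total [k] has entries at most [k], so values in ['I_k.+1] lose
    nothing and make the set finite. *)
Let level k (FF : {set {set I}}) : {set {ffun I -> 'I_k.+1}} :=
  [set f | (supp (nat_of_ffun f) \in FF) && (\sum_i f i == k)%N].

(** Send each member for [FF] to its equivalent for [GG]. The total is preserved by [sim_sum], and
    the map is injective because [FF] has only one member per class. *)
Let leq_card_level k FF GG : transversal FF -> transversal GG ->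
  (#|level k FF| <= #|level k GG|)%N.
Proof.
move=> [_ injF] [surjG _].
have /choice[g gP] : forall f : {ffun I -> 'I_k.+1}, exists f' : {ffun I -> 'I_k.+1},
    f \in level k FF -> f' \in level k GG /\ sim (nat_of_ffun f) (nat_of_ffun f').
  move=> f; have [y yG fy] := surjG (nat_of_ffun f).
  exists [ffun i => inord (y i)]; rewrite inE => /andP[fF /eqP fk].
  have yk : (\sum_i y i = k)%N.
    by rewrite -(sim_sum fy) -[RHS]fk; apply: eq_bigr => i _; rewrite ffunE.
  have yE : nat_of_ffun [ffun i => inord (y i) : 'I_k.+1] = y.
    apply/ffunP => i; rewrite !ffunE inordK // ltnS -yk.
    by rewrite (bigD1 i) //= leq_addr.
  rewrite inE yE yG; split=> //; apply/eqP; rewrite -[RHS]yk.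
  by apply: eq_bigr => i _; rewrite -[in RHS]yE !ffunE.
rewrite -(card_in_imset (f := g) (D := level k FF)).
  by apply: subset_leq_card; apply/fintype.subsetP => _ /imsetP[f /gP[gG _] ->].
move=> f f' fF f'F E; have [_ sf] := gP _ fF; have [_ sf'] := gP _ f'F.
apply: nat_of_ffun_inj; move: fF f'F; rewrite !inE => /andP[fF _] /andP[f'F _].
by apply: injF => //; apply: (sim_trans sf); rewrite E; apply: sim_sym.
Qed.

(* The coefficient of ['X^k] in [parts k ^+ j] counts the compositions of [k]
   into [j] positive parts. *)
Let parts k : {poly int} := \sum_(v < k.+1 | v != 0 :> nat) 'X^v.

(** Group by the support [Y]: the generating function of the multiplicities with support exactly [Y]
    is a product of one factor [parts k] for each element of [Y]. *)
Let sum_level k (FF : {set {set I}}) :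
  (#|level k FF|)%:R = \sum_(Y in FF) (parts k ^+ #|Y|)`_k :> int.
Proof.
transitivity (\sum_(f : {ffun I -> 'I_k.+1} | supp (nat_of_ffun f) \in FF)
    ('X^(\sum_i f i)%N : {poly int})`_k).
  rewrite -sum1_card natr_sum big_mkcond [RHS]big_mkcond /=.
  apply: eq_bigr => f _; rewrite inE coefXn [k == _]eq_sym.
  by case: (_ \in FF) => //=; case: (_ == k).
rewrite (partition_big (fun f => supp (nat_of_ffun f)) (mem FF)) //=.
apply: eq_bigr => Y YF; rewrite -coef_sum; congr (nth _ (polyseq _) _).
rewrite (eq_bigl (fun f => f \in family (fun i =>
  [pred v : 'I_k.+1 | (v != 0 :> nat) == (i \in Y)]))).
  rewrite (eq_bigr (fun f : {ffun I -> 'I_k.+1} => \prod_i ('X^(f i) : {poly int}))).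
    rewrite -(bigA_distr_big_dep (fun i => [pred v : 'I_k.+1 | (v != 0 :> nat) == (i \in Y)])
      (fun _ (v : 'I_k.+1) => 'X^v)) /=.
    rewrite -prodr_const [RHS]big_mkcond; apply: eq_bigr => i _.
    case: ifP => iY; first by apply: eq_bigl => v; rewrite eqb_id.
    rewrite (big_pred1 ord0) ?expr0 // => v.
    by rewrite /= eqbF_neg negbK -val_eqE.
  by move=> f _; rewrite prodrXr.
move=> f; apply/andP/familyP => [[_ /eqP <-] i|fY].
  by rewrite !inE ffunE.
suff E : supp (nat_of_ffun f) = Y by rewrite E YF eqxx.
by apply/setP => i; rewrite !inE ffunE; have := fY i; rewrite !inE => /eqP.
Qed.

Let partsE k : parts k = 'X * \poly_(v < k) 1.
Proof.
rewrite /parts big_mkcond big_ord_recl /= add0r poly_def big_distrr /=.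
by apply: eq_bigr => v _; rewrite scale1r -exprS.
Qed.

(** [parts k] starts with ['X], so the system expressing level sizes through numbers of [j]-element
    sets is unitriangular. *)
Let coef_parts k j : (k <= j)%N -> (parts k ^+ j)`_k = (k == j)%:R.
Proof.
move=> kj; rewrite partsE exprMn.
rewrite coefXnM; case: ltngtP kj => // <- _; rewrite subnn.
(* For [k = 0] the truncated series is the zero polynomial, but its power 0 is still 1. *)
case: k => [|k]; first by rewrite expr0 coefC.
by rewrite -horner_coef0 horner_exp horner_coef0 coef_poly expr1n.
Qed.

(** Strong induction on [j]. In the equality of levels of total [j], smaller sets contribute equally
    by induction, larger ones contribute nothing, and [j]-element sets have coefficient 1. *)
Lemma card_transversal FF GG (j : nat) : transversal FF -> transversal GG ->
  #|[set Y in FF | #|Y| == j]| = #|[set Y in GG | #|Y| == j]|.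
Proof.
move=> trF trG; have [n] := ubnP j; elim: n j => // n IH j ltj.
(* The range of [i] is chosen to contain every possible size [#|Y|] as well as [j] itself. *)
have sumE (HH : {set {set I}}) : \sum_(Y in HH) (parts j ^+ #|Y|)`_j =
    \sum_(i < (#|I| + j).+1) (#|[set Y in HH | #|Y| == i]|)%:R * (parts j ^+ i)`_j.
  rewrite (partition_big (fun Y : {set I} => inord #|Y| : 'I_(#|I| + j).+1) xpredT) //=.
  apply: eq_bigr => i _.
  rewrite (eq_bigl (mem [set Y in HH | #|Y| == i])) => [|Y].
    rewrite (eq_bigr (fun=> (parts j ^+ i)`_j)) => [|Y].
      by rewrite sumr_const mulr_natl.
    by rewrite !inE => /andP[_ /eqP ->].
  rewrite !inE; congr (_ && _); rewrite -val_eqE /= inordK //.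
  by rewrite ltnS (leq_trans (max_card _)) // leq_addr.
have : #|level j FF| = #|level j GG|.
  by apply/eqP; rewrite eqn_leq !leq_card_level.
move=> /(congr1 (fun n : nat => n%:R : int)); rewrite !sum_level !sumE.
have jlt : (j < (#|I| + j).+1)%N by rewrite ltnS leq_addl.
rewrite (bigD1 (Ordinal jlt)) //= [in RHS](bigD1 (Ordinal jlt)) //=.
rewrite coef_parts // eqxx !mulr1 => E; apply/eqP; rewrite -(eqr_nat int); apply/eqP.
move: E; rewrite [X in _ + X = _ -> _](eq_bigr
  (fun i : 'I__ => (#|[set Y in GG | #|Y| == i]|)%:R * (parts j ^+ i)`_j)).
  exact: addIr.
move=> i; rewrite -val_eqE /= => ij.
case: (ltngtP i j) ij => // [ilt|igt] _; last first.
  by rewrite coef_parts ?(ltnW igt) // (ltn_eqF igt) !mulr0.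
by rewrite IH // (leq_trans ilt).
Qed.

End Transversals.

(** * Cycles of a plane graph are coboundaries of its dual *)

(** Rank count: the kernels being at most one-dimensional, [D] has rank at least [#|A| - 1] and [E]
    at least [#|C| - 1]. The kernel of [E] contains the image of [D], and by the cardinality bound
    its dimension is no larger. *)
Lemma two_step_exactness (F : fieldType) (A B C : finType)
    (D : A -> B -> F) (E : B -> C -> F) (kA : A -> F) (kC : C -> F) :
  (forall a c, \sum_b D a b * E b c = 0) ->
  (forall f, (forall b, \sum_a f a * D a b = 0) ->
     exists t, forall a, f a = t * kA a) ->
  (forall h, (forall b, \sum_c E b c * h c = 0) ->
     exists t, forall c, h c = t * kC c) ->
  (#|B| + 2 <= #|A| + #|C|)%N ->
  forall z : B -> F, (forall c, \sum_b z b * E b c = 0) ->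
  exists g : A -> F, forall b, z b = \sum_a g a * D a b.
Proof.
move=> DE kerD kerE card_le z zE.
pose MD : 'M_(#|A|, #|B|) := \matrix_(i, j) D (enum_val i) (enum_val j).
pose ME : 'M_(#|B|, #|C|) := \matrix_(i, j) E (enum_val i) (enum_val j).
have sumE (T : finType) (f : T -> F) : \sum_(i < #|T|) f (enum_val i) = \sum_t f t.
  by rewrite -(big_enum_val f).
have rankD : (#|A| <= \rank MD + 1)%N.
  have : (kermx MD <= \row_i kA (enum_val i))%MS.
    apply/row_subP => i; set u := row i _.
    have uD : u *m MD = 0 by apply/sub_kermxP; exact: row_sub.
    have [|t tP] := kerD (fun a => u 0 (enum_rank a)).
      move=> b; have /rowP/(_ (enum_rank b)) := uD; rewrite !mxE => E0; rewrite -[RHS]E0.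
      by rewrite -[LHS]sumE; apply: eq_bigr => k _; rewrite enum_valK [MD _ _]mxE enum_rankK.
    apply/sub_rVP; exists t; apply/rowP => k.
    by rewrite [RHS]mxE [X in _ * X]mxE -tP enum_valK.
  move=> /mxrankS; rewrite mxrank_ker leq_subLR => /leq_trans; apply.
  by rewrite leq_add2l rank_leq_row.
have rankE : (#|C| <= \rank ME + 1)%N.
  have : (kermx ME^T <= \row_i kC (enum_val i))%MS.
    apply/row_subP => i; set u := row i _.
    have uE : u *m ME^T = 0 by apply/sub_kermxP; exact: row_sub.
    have [|t tP] := kerE (fun c => u 0 (enum_rank c)).
      move=> b; have /rowP/(_ (enum_rank b)) := uE; rewrite !mxE => E0; rewrite -[RHS]E0.
      rewrite -[LHS]sumE; apply: eq_bigr => k _.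
      by rewrite enum_valK mulrC [_^T _ _]mxE [ME _ _]mxE enum_rankK.
    apply/sub_rVP; exists t; apply/rowP => k.
    by rewrite [RHS]mxE [X in _ * X]mxE -tP enum_valK.
  move=> /mxrankS; rewrite mxrank_ker mxrank_tr leq_subLR => /leq_trans; apply.
  by rewrite leq_add2l rank_leq_row.
have DsubE : (MD <= kermx ME)%MS.
  apply/sub_kermxP/matrixP => i j; rewrite !mxE -[RHS](DE (enum_val i) (enum_val j)).
  by rewrite -[RHS]sumE; apply: eq_bigr => k _; rewrite !mxE.
have EsubD : (kermx ME <= MD)%MS.
  have [_ <-] := mxrank_leqif_sup DsubE.
  rewrite eqn_leq mxrankS //= mxrank_ker.
  move: rankD rankE card_le; move: (\rank MD) (\rank ME) => rD rE.
  by move: #|A| #|B| #|C| => *; lia.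
have : (\row_j z (enum_val j) <= MD)%MS.
  apply: submx_trans EsubD; apply/sub_kermxP/rowP => j; rewrite !mxE.
  rewrite -[RHS](zE (enum_val j)) -[RHS]sumE.
  by apply: eq_bigr => k _; rewrite !mxE.
case/submxP => g gE; exists (fun a => g 0 (enum_rank a)) => b.
have /rowP/(_ (enum_rank b)) := gE; rewrite !mxE enum_rankK => ->.
by rewrite -[RHS]sumE; apply: eq_bigr => k _; rewrite enum_valK [MD _ _]mxE enum_rankK.
Qed.

Section PlaneDuality.
Variables (G : bigraph) (Gconn : bigraph_connected G).

Lemma bigraph_connected_ind (P : Eside G + Vside G -> Prop) :
  (forall a, P (inl (eend a)) <-> P (inr (vend a))) ->
  forall x y, P x -> P y.
Proof.
move=> HP x y Px; have /connectP[p] := (Gconn.2 x y).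
elim: p x Px => [|w p IH] x Px /=; first by move=> _ ->.
move=> /andP[xw pw] yE; apply: (IH w) => //.
by case: x w xw Px {pw yE IH} => [e|v] [e'|v'] //= /existsP[a /andP[/eqP <- /eqP <-]] /HP.
Qed.

Variables (M : rotation_system G).

Lemma left_region_next x : left_region M (face_next M x) = left_region M x.
Proof.
apply: val_inj; apply/setP => y; rewrite !inE.
by rewrite -(same_fconnect1 (@face_next_inj _ M)).
Qed.

Lemma left_region_surj (r : region M) :
  (0 < #|edge G|)%N -> exists x, r = left_region M x.
Proof.
move=> m0; case: r => A AP; have := AP; rewrite {1}/region_set ifN -?lt0n //.
by case/imsetP => x _ AE; exists x; apply: val_inj.
Qed.

(** Consecutive edges around a vertex share a region, so [f] takes one value on the regions beside
    all edges at that vertex. Connectedness of [G] carries this value to every vertex. *)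
Lemma region_connected (X : eqType) (f : region M -> X) :
  (forall a : edge G, f (left_region M (a, true)) = f (left_region M (a, false))) ->
  forall r r', f r = f r'.
Proof.
move=> fE r r'; have [m0|] := posnP #|edge G|.
  suff -> : r = r' by [].
  case: r r' => [A AP] [B BP]; apply: val_inj => /=.
  by move: AP BP; rewrite /region_set m0 /= !inE => /eqP -> /eqP ->.
move=> m0; pose k a := f (left_region M (a, true)).
have kE a b : eend b = eend a -> k b = k a.
  move=> /eqP; rewrite -(rotEP M a b) => /porbitP[i ->] {b}.
  elim: i => [|i IH]; first by rewrite expg0 perm1.
  rewrite -{}IH expgSr permM; move: (fun_of_perm _ a) => b.
  rewrite /k.
  by rewrite [LHS]fE -left_region_next /face_next /= permK.
have kV a b : vend b = vend a -> k b = k a.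
  move=> /eqP; rewrite -(rotVP M a b) => /porbitP[i ->] {b}.
  elim: i => [|i IH]; first by rewrite expg0 perm1.
  rewrite -{}IH expgSr permM; move: (fun_of_perm _ a) => b.
  by rewrite /k -left_region_next /face_next /= permK -fE.
have /card_gt0P[a0 _] := m0.
pose P (w : Eside G + Vside G) := match w with
  | inl e => forall b, eend b = e -> k b = k a0
  | inr v => forall b, vend b = v -> k b = k a0 end.
have Pall w : P w.
  apply: (@bigraph_connected_ind P _ (inl (eend a0))); last by move=> b /kE.
  move=> a; split=> H b /= bE.
    by rewrite (kV a) //; apply: H.
  by rewrite (kE a) //; apply: H.
have call x : f (left_region M x) = k a0.
  case: x => b [|]; last rewrite -fE; exact: (Pall (inl (eend b))).
by have [[x ->] [y ->]] := (left_region_surj r m0, left_region_surj r' m0); rewrite !call.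
Qed.

(** Around a vertex, the region on one side of an edge is the region on the other side of the next
    edge, so the sum telescopes cyclically. *)
Lemma coboundary_sum (Z : zmodType) (g : region M -> Z) :
  (forall e, \sum_(a | eend a == e)
     (g (left_region M (a, false)) - g (left_region M (a, true))) = 0) /\
  (forall v, \sum_(a | vend a == v)
     (g (left_region M (a, false)) - g (left_region M (a, true))) = 0).
Proof.
split=> w; rewrite sumrB; apply/eqP; rewrite subr_eq0; apply/eqP.
  rewrite (reindex_inj (@perm_inj _ (rotE M))) /=; apply: eq_big => [a|a _].
    have /eqP -> // : eend (rotE M a) == eend a.
    by rewrite -(rotEP M); have := mem_porbit (rotE M) 1 a; rewrite expg1.
  by rewrite -left_region_next /face_next /= permK.
rewrite [RHS](reindex_inj (@perm_inj _ (rotV M))) /=; apply: eq_big => [a|a _].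
  have /eqP -> // : vend (rotV M a) == vend a.
  by rewrite -(rotVP M); have := mem_porbit (rotV M) 1 a; rewrite expg1.
by rewrite -[in RHS]left_region_next /face_next /= permK.
Qed.

(** Exactness over the rationals at the edges, between regions and vertices; Euler's formula
    supplies the cardinality bound. *)
Lemma cycle_coboundary (Mplane : spherical M) (r0 : region M) (z : edge G -> int) :
  (forall e, \sum_(a | eend a == e) z a = 0) ->
  (forall v, \sum_(a | vend a == v) z a = 0) ->
  exists2 g : region M -> int, g r0 = 0 &
    forall a, z a = g (left_region M (a, false)) - g (left_region M (a, true)).
Proof.
move=> zE zV.
pose L a b : region M := left_region M (a, b).
pose D (r : region M) (a : edge G) : rat :=
  (r == L a false)%:R - (r == L a true)%:R.
pose inc (a : edge G) (w : Eside G + Vside G) : rat := match w with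
  | inl e => (eend a == e)%:R | inr v => (vend a == v)%:R end.
(* The incidence [inc] is unsigned, so its kernel on vertex functions is spanned by the sign of the
   bipartition rather than by constants. *)
pose sgn (w : Eside G + Vside G) : rat := if w is inl _ then 1 else -1.
have sumD (f : region M -> rat) a :
    \sum_r f r * D r a = f (L a false) - f (L a true).
  rewrite /D; under eq_bigr do rewrite mulrBr; rewrite sumrB.
  have pick r0' : \sum_r f r * (r == r0')%:R = f r0'.
    by rewrite (bigD1 r0') //= eqxx mulr1 big1 ?addr0 // => r /negPf ->; rewrite mulr0.
  by rewrite !pick.
have [|||||g gP] := @two_step_exactness rat _ _ _ D inc (fun=> 1) sgn _ _ _ _
    (fun a => (z a)%:~R).
- move=> r w; have [HE HV] := coboundary_sum (fun r' => (r == r')%:R : rat).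
  by case: w => w /=; [rewrite -[RHS](HE w)|rewrite -[RHS](HV w)]; rewrite [RHS]big_mkcond;
    apply: eq_bigr => a _; rewrite /D /L; case: ifP => _; rewrite ?mulr1 ?mulr0.
- move=> f f0; exists (f r0) => r; rewrite mulr1; apply: region_connected => a.
  by apply/eqP; rewrite eq_sym -subr_eq0 -sumD f0.
- move=> h h0.
  have hE a : h (inl (eend a)) = - h (inr (vend a)).
    apply/eqP; rewrite -addr_eq0 -[0](h0 a) big_sumType /=.
    rewrite (bigD1 (eend a)) //= eqxx mul1r big1 ?addr0; last first.
      by move=> e /negPf; rewrite eq_sym => ->; rewrite mul0r.
    rewrite (bigD1 (vend a)) //= eqxx mul1r big1 ?addr0 //.
    by move=> v /negPf; rewrite eq_sym => ->; rewrite mul0r.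
  have /card_gt0P[w0 _] : (0 < #|{: Eside G + Vside G}|)%N.
    by rewrite card_sum; exact: Gconn.1.
  exists (h w0 * sgn w0) => w.
  apply: (@bigraph_connected_ind (fun w => h w = h w0 * sgn w0 * sgn w) _ w0).
    by move=> a /=; rewrite hE mulr1 mulrN1; split=> [<-|->]; rewrite opprK.
  by rewrite -mulrA; case: (w0) => ? /=; rewrite ?mulrNN !mulr1.
- by rewrite card_sum -Mplane addnC.
- have E (P : pred (edge G)) (c : edge G -> rat) : (forall a, c a = (P a)%:R) ->
      \sum_(a | P a) z a = 0 -> \sum_a (z a)%:~R * c a = 0.
    move=> cE z0; rewrite -[RHS](mulr0z 1) -[in RHS]z0 rmorph_sum [RHS]big_mkcond /=.
    by apply: eq_bigr => a _; rewrite cE; case: (P a); rewrite ?mulr1 ?mulr0.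
  by case=> w; apply: (E _ _ (fun=> erefl)).
have zg a : (z a)%:~R = g (L a false) - g (L a true) by rewrite gP sumD.
(* Integrality spreads from [r0], since the jump of [g] across each edge is the integer [z a]. *)
have gint r : g r - g r0 \is a Num.int.
  rewrite (@region_connected _ (fun r => g r - g r0 \is a Num.int) _ r r0).
    by rewrite subrr.
  move=> a; rewrite -!/(L _ _).
  have -> : g (L a true) - g r0 = (g (L a false) - g r0) - (z a)%:~R by rewrite zg; ring.
  by rewrite rpredBr ?intr_int.
exists (fun r => Num.floor (g r - g r0)); first by rewrite subrr floor0.
move=> a; apply: (@intr_inj rat); rewrite zg rmorphB /= !floorK //.
by rewrite /L; ring.
Qed.

End PlaneDuality.

(** * Edge multiplicities with equal vertex sums *)

Section SameEnds.
Variable G : bigraph.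
Implicit Types x y z : {ffun edge G -> nat}.

Definition same_ends x y : Prop :=
  (forall e, \sum_(a | eend a == e) x a = \sum_(a | eend a == e) y a)%N /\
  (forall v, \sum_(a | vend a == v) x a = \sum_(a | vend a == v) y a)%N.

Lemma same_ends_sym x y : same_ends x y -> same_ends y x.
Proof. by move=> [E V]; split=> w. Qed.

Lemma same_ends_trans y x z : same_ends x y -> same_ends y z -> same_ends x z.
Proof. by move=> [E V] [E' V']; split=> w; rewrite (E, V) (E', V'). Qed.

Lemma same_ends_sum x y : same_ends x y -> (\sum_a x a = \sum_a y a)%N.
Proof.
move=> [E _]; rewrite (partition_big (@eend G) xpredT) //=.
by rewrite [RHS](partition_big (@eend G) xpredT) //=; apply: eq_bigr => e _.
Qed.

Lemma same_endsP x y : same_ends x y <->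
  (forall e, \sum_(a | eend a == e) ((y a)%:Z - (x a)%:Z) = 0) /\
  (forall v, \sum_(a | vend a == v) ((y a)%:Z - (x a)%:Z) = 0).
Proof.
have sumE (P : pred (edge G)) : (\sum_(a | P a) x a = \sum_(a | P a) y a)%N <->
    \sum_(a | P a) ((y a)%:Z - (x a)%:Z) = 0.
  rewrite sumrB -!(big_morph Posz PoszD (erefl (Posz 0))).
  by split=> [->|/eqP]; [rewrite subrr | rewrite subr_eq0 => /eqP[->]].
by split=> -[E V]; split=> w; apply/sumE.
Qed.

End SameEnds.

(** * Complements of root-connected arc sets of the dual are transversal *)

Section DualTransversal.
Variables (G : bigraph) (Gconn : bigraph_connected G).
Variables (M : rotation_system G) (Mplane : spherical M) (r0 : vertex (dual M)).
Implicit Types x y : {ffun edge G -> nat}.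

Definition dual_spanning : {set {set edge G}} :=
  [set Y : {set edge G} |
    root_spanning (@tail (dual M)) (@Defs.head (dual M)) [set r0] (~: Y)].

(** Otherwise the set where [g < 0] avoids [r0] and is entered by an arc [a] with [x a = 0]. The
    potential drops along [a], which would make [y a] negative. *)
Lemma dual_spanning_potential_ge0 x y (g : region M -> int) :
  supp x \in dual_spanning -> g r0 = 0 ->
  (forall a, (y a)%:Z - (x a)%:Z =
     g (left_region M (a, false)) - g (left_region M (a, true))) ->
  forall r, 0 <= g r.
Proof.
rewrite inE => /root_spanningP span g0 gE r; rewrite leNgt; apply/negP => gr.
have [||a []] := span [set r | g r < 0].
- by apply/set0Pn; exists r; rewrite inE.
- by rewrite disjoint_sym disjoints1 inE g0 ltxx.
rewrite !inE negbK /= => /eqP xa ga; rewrite -leNgt => ga'.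
have := gE a; rewrite xa.
move: ga ga'; move: (g _) (g (left_region M (a, true))) (y a) => p q n; lia.
Qed.

(** Uniqueness: the potential between two members is non-negative in both directions, hence zero.
    Existence: minimize the total potential over the class; a set of regions violating the spanning
    condition could be fired to lower it. *)
Lemma dual_transversal : transversal (@same_ends G) dual_spanning.
Proof.
split=> [x|x y xF yF /same_endsP[xyE xyV]]; last first.
  have [g g0 gE] := cycle_coboundary Gconn Mplane r0 xyE xyV.
  have g_ge0 := dual_spanning_potential_ge0 xF g0 gE.
  have gN_ge0 : forall r, 0 <= - g r.
    by apply: (dual_spanning_potential_ge0 (y := x) yF) => [|a];
      [rewrite g0 oppr0|rewrite -opprB gE; ring].
  have {}g0 r : g r = 0 by apply/eqP; rewrite eq_le -oppr_ge0 gN_ge0 g_ge0.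
  by apply/ffunP => a; have /eqP := gE a; rewrite !g0 subrr subr_eq0 => /eqP[].
have /choice[pot potP] : forall y, exists g : region M -> int, same_ends x y ->
    g r0 = 0 /\ forall a, (y a)%:Z - (x a)%:Z =
      g (left_region M (a, false)) - g (left_region M (a, true)).
  move=> y; have [/same_endsP[xyE xyV]|] := pselect (same_ends x y); last by exists (fun=> 0).
  by have [g g0 gE] := cycle_coboundary Gconn Mplane r0 xyE xyV; exists g.
pose k := (\sum_a x a)%N.
(* All members of the class have total [k], so the minimum is taken over a finite type. *)
pose value (f : {ffun edge G -> 'I_k.+1}) : {ffun edge G -> nat} := [ffun a => nat_of_ord (f a)].
have value_surj y : same_ends x y -> exists f, value f = y.
  move=> /same_ends_sum xy; exists [ffun a => inord (y a)]; apply/ffunP => a.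
  by rewrite !ffunE inordK // ltnS /k xy (bigD1 a) //= leq_addr.
have [f0 f0E] := value_surj x (conj (fun=> erefl) (fun=> erefl)).
have xf0 : `[< same_ends x (value f0) >] by apply/asboolP; rewrite f0E; split.
have [f /asboolP xf fmin] := @arg_minP _ _ _ f0
   (fun f => `[< same_ends x (value f) >]) (fun f => \sum_r pot (value f) r) xf0.
exists (value f) => //; rewrite inE; apply/root_spanningP => D D0.
rewrite disjoint_sym disjoints1 => r0D.
apply: contrapT => noarc.
have pos a : left_region M (a, false) \in D -> left_region M (a, true) \notin D ->
    (0 < value f a)%N.
  move=> aD aD'; rewrite lt0n; apply/negP => xa; apply: noarc; exists a.
  by rewrite !inE negbK xa.
(* Firing [D] takes one from each arc entering [D] and adds one to each arc leaving it. By [pos] the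
   subtraction never truncates. *)
pose y : {ffun edge G -> nat} := [ffun a =>
  (value f a + (left_region M (a, true) \in D) - (left_region M (a, false) \in D))%N].
have yE a : (y a)%:Z - (value f a)%:Z =
    - (left_region M (a, false) \in D)%:Z - - (left_region M (a, true) \in D)%:Z.
  have := pos a; rewrite [y a]ffunE; move: (value f a) => n.
  by case: (_ \in D); case: (_ \in D) => /=; lia.
have fy : same_ends (value f) y.
  apply/same_endsP; have [E V] := coboundary_sum (fun r => - (r \in D)%:Z : int).
  by split=> w; [rewrite -[RHS](E w)|rewrite -[RHS](V w)]; apply: eq_bigr => a _; rewrite yE.
have xy := same_ends_trans xf fy.
have [pf0 pfE] := potP _ xf; have [py0 pyE] := potP _ xy.
(* Both sides have the same coboundary and vanish at [r0], so they agree by connectedness of the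
   dual. *)
have potE r : pot y r = pot (value f) r - (r \in D)%:Z.
  have := @region_connected _ Gconn M _
    (fun r => pot y r - (pot (value f) r - (r \in D)%:Z)) _ r r0.
  rewrite py0 pf0 (negPf r0D) => E; apply/eqP; rewrite -subr_eq0 E //.
  move=> a; have := yE a; have := pyE a; have := pfE a.
  move: (pot y (left_region M (a, false))) (pot y (left_region M (a, true))).
  move: (pot (value f) (left_region M (a, false))) (pot (value f) (left_region M (a, true))).
  by move=> p p' q q'; move: (x a) (y a) (value f a) (_ \in D) (_ \in D) => *; lia.
have [f' f'E] := value_surj y xy.
have := fmin f'; rewrite f'E => /(_ (asboolT xy)).
rewrite [X in _ <= X](eq_bigr _ (fun r _ => potE r)).
rewrite sumrB lerDl oppr_ge0 leNgt => /negP[].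
rewrite -(big_morph Posz PoszD (erefl (Posz 0))) ltz_nat; have /set0Pn[r rD] := D0.
by rewrite (bigD1 r) //= rD.
Qed.

End DualTransversal.

(** * Root polytopes *)

Lemma linear_dependence (F : fieldType) (B C : finType) (E : B -> C -> F) (h : C -> F) c0 :
  h c0 != 0 -> (forall b, \sum_c E b c * h c = 0) -> (#|C| <= #|B|)%N ->
  exists2 z : B -> F, exists b, z b != 0 & forall c, \sum_b z b * E b c = 0.
Proof.
move=> hc0 Eh card_le.
pose ME : 'M_(#|B|, #|C|) := \matrix_(i, j) E (enum_val i) (enum_val j).
have sumE (T : finType) (f : T -> F) : \sum_(i < #|T|) f (enum_val i) = \sum_t f t.
  by rewrite -(big_enum_val f).
have rankE : (\rank ME < #|C|)%N.
  rewrite -mxrank_tr -subn_gt0 -mxrank_ker lt0n mxrank_eq0; apply/rowV0Pn.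
  exists (\row_i h (enum_val i)); last first.
    apply: contra_neq hc0 => /rowP/(_ (enum_rank c0)).
    by rewrite !mxE enum_rankK.
  apply/sub_kermxP/rowP => b; rewrite !mxE -[RHS](Eh (enum_val b)) -[RHS]sumE.
  by apply: eq_bigr => k _; rewrite !mxE mulrC.
have : kermx ME != 0.
  by rewrite -mxrank_eq0 -lt0n mxrank_ker subn_gt0 (leq_trans rankE).
case/rowV0Pn => z /sub_kermxP/rowP zE /rV0Pn[i zi].
exists (fun b => z 0 (enum_rank b)) => [|c]; first by exists (enum_val i); rewrite enum_valK.
have := zE (enum_rank c); rewrite !mxE => E0; rewrite -[RHS]E0 -[LHS]sumE.
by apply: eq_bigr => k _; rewrite enum_valK [ME _ _]mxE enum_rankK.
Qed.

Section Hulls.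
Variables (R : realType) (W : lmodType R).

Lemma hull_mem (S : {fset W}) p : p \in S -> hull S p.
Proof.
move=> pS; exists (fun q => (q == p)%:R); split=> [q _||]; first exact: ler0n.
  rewrite (big_fsetD1 p) //= eqxx big_seq big1 ?addr0 // => q.
  by rewrite !inE => /andP[/negPf -> _].
rewrite (big_fsetD1 p) //= eqxx scale1r big_seq big1 ?addr0 // => q.
by rewrite !inE => /andP[/negPf -> _]; rewrite scale0r.
Qed.

(** Pick [q] with positive weight in a convex expression of [x]. Either its weight is 1 and [x = q],
    or [x] lies strictly between [q] and the renormalized remainder [z], and extremality gives
    [q = x]. *)
Lemma vertex_of_hull (S : {fset W}) x : vertex_of (hull S) x -> x \in S.
Proof.
move=> [[w [w0 w1 xE]] xvert].
have [q qS wq] : exists2 q, q \in S & 0 < w q.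
  apply: contrapT => H; have : \sum_(p <- S) w p = 0.
    rewrite big_seq big1 // => p pS; apply/eqP; rewrite eq_le w0 // andbT leNgt.
    by apply/negP => wp; apply: H; exists p.
  by rewrite w1 => /eqP; rewrite oner_eq0.
have S1 : w q + \sum_(p <- (S `\ q)%fset) w p = 1 by rewrite -w1 [RHS](big_fsetD1 q).
have xE' : x = w q *: q + \sum_(p <- (S `\ q)%fset) w p *: p by rewrite xE [LHS](big_fsetD1 q).
have wD p : p \in (S `\ q)%fset -> 0 <= w p by rewrite !inE => /andP[_ /w0].
have [wq1|wq1] := eqVneq (w q) 1.
  have wD0 p : p \in (S `\ q)%fset -> w p = 0.
    move=> pD; have s0 : \sum_(p <- (S `\ q)%fset) w p = 0.
      by apply: (addrI 1); rewrite addr0 -{1}wq1.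
    apply/eqP; rewrite eq_le wD // andbT -s0 (big_fsetD1 p) //= lerDl big_seq sumr_ge0 // => p'.
    by rewrite in_fsetD1 => /andP[_ /wD].
  by rewrite xE' wq1 scale1r big_seq big1 ?addr0 // => p /wD0 ->; rewrite scale0r.
have wq_lt1 : w q < 1.
  by rewrite lt_neqAle wq1 -S1 lerDl big_seq sumr_ge0.
have nz : 1 - w q != 0 by rewrite subr_eq0 eq_sym.
pose z := \sum_(p <- (S `\ q)%fset) (w p / (1 - w q)) *: p.
have zS : hull S z.
  exists (fun p => if p == q then 0 else w p / (1 - w q)); split.
  - by move=> p pS; case: eqP => // _; rewrite divr_ge0 ?w0 // subr_ge0 ltW.
  - rewrite (big_fsetD1 q) //= eqxx add0r big_seq.
    rewrite (eq_bigr (fun p => w p / (1 - w q))) => [|p].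
      by rewrite -big_seq -mulr_suml -[X in X / _](addKr (w q)) S1 addrC divff.
    by rewrite !inE => /andP[/negPf -> _].
  - rewrite (big_fsetD1 q) //= eqxx scale0r add0r /z big_seq [RHS]big_seq.
    by apply: eq_bigr => p; rewrite !inE => /andP[/negPf -> _].
have [] := xvert (w q) q z; rewrite ?wq ?wq_lt1 //.
- exact: hull_mem.
- rewrite xE' /z scaler_sumr; congr (_ + _); apply: eq_bigr => p _.
  by rewrite scalerA mulrCA divff // mulr1.
- by move=> <-.
Qed.

End Hulls.

(** * Linear combinations of edge points *)

Section EdgePoints.
Variables (R : realType) (G : bigraph).
Implicit Types (c d : edge G -> R) (S : {fset ambient R G}).
Local Notation pt := (@edge_point R G).

Definition comb c : ambient R G := \sum_a c a *: pt a.

Lemma comb_fst c e : (comb c).1 e = \sum_(a | eend a == e) c a.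
Proof.
rewrite /comb (raddf_sum (@fst _ _)) sum_ffunE [RHS]big_mkcond /=.
apply: eq_bigr => a _; rewrite !ffunE eq_sym.
by case: eqP => _; rewrite /GRing.scale /= ?mulr1 ?mulr0.
Qed.

Lemma comb_snd c v : (comb c).2 v = \sum_(a | vend a == v) c a.
Proof.
rewrite /comb (raddf_sum (@snd _ _)) sum_ffunE [RHS]big_mkcond /=.
apply: eq_bigr => a _; rewrite !ffunE eq_sym.
by case: eqP => _; rewrite /GRing.scale /= ?mulr1 ?mulr0.
Qed.

Lemma combP c d : comb c = comb d <->
  (forall e, \sum_(a | eend a == e) c a = \sum_(a | eend a == e) d a) /\
  (forall v, \sum_(a | vend a == v) c a = \sum_(a | vend a == v) d a).
Proof.
split=> [E|[HE HV]].
  by split=> w; rewrite -?comb_fst -?comb_snd E.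
rewrite [LHS]surjective_pairing [RHS]surjective_pairing.
by congr pair; apply/ffunP => w; rewrite ?comb_fst ?comb_snd.
Qed.

Lemma comb_sum c d : comb c = comb d -> \sum_a c a = \sum_a d a.
Proof.
move=> /combP[E _]; rewrite (partition_big (@eend G) xpredT) //=.
by rewrite [RHS](partition_big (@eend G) xpredT) //=; apply: eq_bigr.
Qed.

Lemma combB c d : comb (fun a => c a - d a) = comb c - comb d.
Proof. by rewrite /comb -sumrB; apply: eq_bigr => a _; rewrite scalerBl. Qed.

Lemma combZ t c : comb (fun a => t * c a) = t *: comb c.
Proof. by rewrite /comb scaler_sumr; apply: eq_bigr => a _; rewrite scalerA. Qed.

Lemma same_ends_comb (x y : {ffun edge G -> nat}) :
  same_ends x y <-> comb (fun a => (x a)%:R) = comb (fun a => (y a)%:R).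
Proof.
have sumE (P : pred (edge G)) : (\sum_(a | P a) x a = \sum_(a | P a) y a)%N <->
    \sum_(a | P a) (x a)%:R = \sum_(a | P a) (y a)%:R :> R.
  by rewrite -!natr_sum; split=> [->//|/eqP]; rewrite eqr_nat => /eqP.
by rewrite combP; split=> -[E V]; split=> w; apply/sumE.
Qed.

Lemma hull_comb S c : (forall a, 0 <= c a) -> (forall a, c a != 0 -> pt a \in S) ->
  \sum_a c a = 1 -> hull S (comb c).
Proof.
move=> c0 cS c1.
have sumS (V : lmodType R) (f : edge G -> V) : (forall a, c a = 0 -> f a = 0) ->
    \sum_(p <- S) \sum_(a | pt a == p) f a = \sum_a f a.
  move=> f0; rewrite (exchange_big_dep xpredT) //=; apply: eq_bigr => a _.
  have [ca|ca] := eqVneq (c a) 0; first by rewrite f0 // big1.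
  rewrite big_mkcond (big_fsetD1 (pt a)) ?cS //= eqxx big_seq big1 ?addr0 // => p.
  by rewrite !inE eq_sym => /andP[/negPf ->].
(* Parallel edges give the same point, whose weight collects all their coefficients. *)
exists (fun p => \sum_(a | pt a == p) c a); split.
- by move=> p _; apply: sumr_ge0.
- by rewrite (sumS R^o).
- rewrite /comb -sumS => [|a ->]; last by rewrite scale0r.
  apply: eq_bigr => p _; rewrite scaler_suml.
  by apply: eq_bigr => a /eqP ->.
Qed.

(* One representative for each class of parallel edges. *)
Definition canonical_edges : {set edge G} :=
  [set a | [pick b | pt b == pt a] == Some a].

Lemma canonical_edges_inj : {in canonical_edges &, injective pt}.
Proof.
move=> a b; rewrite !inE => /eqP ca /eqP cb E.
by move: ca; rewrite E cb => -[].
Qed.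

Lemma canonical_edge_exists a : exists2 b, b \in canonical_edges & pt b = pt a.
Proof.
case E: [pick b | pt b == pt a] => [b|]; last by move: E; case: pickP => // /(_ a); rewrite eqxx.
have ab : pt b == pt a by move: E; case: pickP => // b' ? [<-].
exists b; last exact/eqP; rewrite inE -E; apply/eqP/eq_pick => b' /=.
by rewrite (eqP ab).
Qed.

(** Using canonical edges only keeps parallel edges out of a common face and makes edge sets
    correspond one-to-one to point sets. *)
Definition edges_of S : {set edge G} := [set a in canonical_edges | pt a \in S].

Definition edge_points_only S := forall p, p \in S -> exists a, pt a = p.

Lemma sum_edges_of S (V : nmodType) (f : ambient R G -> V) : edge_points_only S ->
  \sum_(p <- S) f p = \sum_(a in edges_of S) f (pt a).
Proof.
move=> SE; rewrite -big_enum /= -(big_map pt xpredT f); apply: perm_big.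
apply: uniq_perm => [||p]; first exact: fset_uniq.
  rewrite map_inj_in_uniq ?enum_uniq // => a b; rewrite !mem_enum !inE.
  move=> /andP[ca _] /andP[cb _]; apply: canonical_edges_inj; by rewrite inE.
apply/idP/mapP => [pS|[a]]; last by rewrite mem_enum inE => /andP[_ ?] ->.
have [a aE] := SE p pS; have [b bC bE] := canonical_edge_exists a.
by exists b; rewrite ?bE // mem_enum inE bC bE aE.
Qed.

Lemma hull_combP S z : edge_points_only S -> hull S z ->
  exists c, [/\ forall a, 0 <= c a, forall a, c a != 0 -> a \in edges_of S & z = comb c].
Proof.
move=> SE [w [w0 _ ->]]; exists (fun a => if a \in edges_of S then w (pt a) else 0).
split=> [a|a|]; first by case: ifP => //; rewrite inE => /andP[_ /w0].
  by case: ifP => //; rewrite eqxx.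
rewrite sum_edges_of // /comb big_mkcond; apply: eq_bigr => a _.
by case: ifP => _; rewrite ?scale0r.
Qed.

(** Equal combinations have equal coefficient sums, so [c - d] is an affine relation and affine
    independence suffices. *)
Lemma comb_inj S c d : edge_points_only S -> affinely_independent S ->
  (forall a, c a != 0 -> a \in edges_of S) ->
  (forall a, d a != 0 -> a \in edges_of S) -> comb c = comb d -> c =1 d.
Proof.
move=> SE Sind cS dS E a.
have out b : b \notin edges_of S -> c b - d b = 0.
  by move=> bS; rewrite (contraNeq (cS b) bS) (contraNeq (dS b) bS) subrr.
pose w p := if [pick b in edges_of S | pt b == p] is Some b then c b - d b else 0.
have wE b : b \in edges_of S -> w (pt b) = c b - d b.
  rewrite /w => bS; case: pickP => [b' /andP[b'S /eqP]|/(_ b)]; last by rewrite bS eqxx.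
  move: bS b'S; rewrite !inE => /andP[bC _] /andP[b'C _] E'.
  by rewrite (canonical_edges_inj _ _ E') ?inE.
apply/eqP; rewrite -subr_eq0; apply/eqP.
have [aS|] := boolP (a \in edges_of S); last exact: out.
rewrite -wE //; apply: (Sind w); last by move: aS; rewrite inE => /andP[].
- rewrite sum_edges_of // (eq_bigr (fun b => c b - d b)) //.
  rewrite -[RHS](subrr (\sum_b c b)) [in X in _ - X](comb_sum E) -sumrB big_mkcond.
  by apply: eq_bigr => b _; case: ifPn => // /out.
- rewrite sum_edges_of // (eq_bigr (fun b => (c b - d b) *: pt b)) => [|b bS]; last by rewrite wE.
  rewrite -[RHS](subrr (comb c)) [in X in _ - X]E -combB /comb big_mkcond.
  by apply: eq_bigr => b _; case: ifPn => // /out ->; rewrite scale0r.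
Qed.

(* Unimodularity. The edges with non-integral coefficient form a subgraph without
   vertices of degree 1, hence with at least as many edges as vertices, so that
   their edge points are dependent. *)
Lemma comb_integral c :
  (forall d, (forall a, d a != 0 -> c a != 0) -> comb d = 0 -> forall a, d a = 0) ->
  (forall e, (comb c).1 e \is a Num.int) -> (forall v, (comb c).2 v \is a Num.int) ->
  forall a, c a \is a Num.int.
Proof.
move=> cind cE cV.
pose U := [set a | c a \isn't a Num.int].
suff U0 : U = finset.set0 by move=> a; have /setP/(_ a) := U0; rewrite !inE => /negbFE.
apply/eqP; apply: contraT => Un0.
(* An end of exactly one edge of [U] would have a non-integral vertex sum, so each end of [U] meets
   at least two edges of [U]. *)
have deg2 (X : finType) (f : edge G -> X) :
    (forall x, \sum_(a | f a == x) c a \is a Num.int) -> (#|f @: U|.*2 <= #|U|)%N.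
  move=> fint; rewrite -muln2 -sum_nat_const -(sum1_card (mem U)) (partition_big_imset f) /=.
  apply: leq_sum => _ /imsetP[a aU ->]; rewrite (bigD1 a) /= ?aU ?eqxx // add1n ltnS lt0n.
  apply/negP; rewrite sum_nat_eq0 => /forallP s0.
  have := fint (f a); rewrite (bigD1 a) //= rpredDr; first by move: aU; rewrite inE => /negPf ->.
  apply: rpred_sum => b /andP[fb ba]; have := s0 b; rewrite fb ba andbT implybF.
  by rewrite andbT [b \in mem U]inE negbK.
have E2 := deg2 _ (@eend G) (fun e => eq_ind _ (fun r => r \is a Num.int) (cE e) _ (comb_fst c e)).
have V2 := deg2 _ (@vend G) (fun e => eq_ind _ (fun r => r \is a Num.int) (cV e) _ (comb_snd c e)).
have /set0Pn[a0 a0U] := Un0.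
pose EU := {e : Eside G | e \in (@eend G) @: U}.
pose VU := {v : Vside G | v \in (@vend G) @: U}.
pose UT := {a : edge G | a \in U}.
pose inc (a : UT) (w : EU + VU) : R := match w with
  | inl e => (eend (val a) == val e)%:R | inr v => (vend (val a) == val v)%:R end.
pose e0 : EU := exist _ (eend a0) (imset_f _ a0U).
(* The sign of the bipartition is a kernel vector of the incidence matrix, and the two bounds by
   [#|U|] add up to at most [#|U|] vertices. *)
have [||z [b zb] zE] := @linear_dependence R _ _ inc
    (fun w => if w is inl _ then 1 else -1) (inl e0) (oner_neq0 _).
- move=> a; rewrite big_sumType /=.
  rewrite (bigD1 (exist _ (eend (val a)) (imset_f _ (valP a)) : EU)) //= eqxx mulr1.
  rewrite big1 ?addr0 => [|e]; last first.
    by rewrite -val_eqE eq_sym => /negPf /= ->; rewrite mul0r.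
  rewrite (bigD1 (exist _ (vend (val a)) (imset_f _ (valP a)) : VU)) //= eqxx mulrN1.
  rewrite big1 ?addr0 ?subrr // => v.
  by rewrite -val_eqE eq_sym => /negPf /= ->; rewrite mul0r.
- by rewrite card_sum !card_sig -leq_double doubleD -[leqRHS]addnn leq_add.
pose d a := oapp z 0 (insub a : option UT).
have dsum (P : pred (edge G)) : \sum_(a | P a) d a = \sum_(a : UT) z a * (P (val a))%:R.
  rewrite big_mkcond (bigID (mem U)) /= [X in _ + X]big1 ?addr0 => [|a aU]; last first.
    by rewrite /d insubF ?if_same //; apply/negbTE.
  rewrite big_sub; apply: eq_bigr => a _; rewrite /d valK /=.
  by case: (P _); rewrite ?mulr1 ?mulr0.
have := cind d _ _ (val b); rewrite /d valK /= => H; case/eqP: zb; apply: H.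
  move=> a; rewrite /d; case: insubP => [a' + _ _ /=|]; last by rewrite eqxx.
  by rewrite inE; apply: contraNneq => ->; rewrite rpred0.
rewrite [RHS](_ : _ = comb (fun=> 0)); last first.
  by rewrite /comb big1 // => a _; rewrite scale0r.
apply/combP; split=> w; rewrite [RHS]big1 // dsum.
- have [wU|wU] := boolP (w \in (@eend G) @: U); first exact: (zE (inl (exist _ w wU))).
  rewrite big1 // => a _; case: eqP => [aw|_]; last by rewrite mulr0.
  by case/negP: wU; rewrite -aw imset_f // (valP a).
- have [wU|wU] := boolP (w \in (@vend G) @: U); first exact: (zE (inr (exist _ w wU))).
  rewrite big1 // => a _; case: eqP => [aw|_]; last by rewrite mulr0.
  by case/negP: wU; rewrite -aw imset_f // (valP a).
Qed.

End EdgePoints.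

(** * Faces of a triangulation are transversal *)

Section Faces.
Variables (R : realType) (G : bigraph) (T : {fset {fset ambient R G}}).
Hypothesis Ttri : root_triangulation T.
Implicit Types (S : {fset ambient R G}) (Y : {set edge G}).
Local Notation pt := (@edge_point R G).

(** The empty face is added explicitly because [T] itself may be empty when the polytope is, as for
    the one-vertex graph. *)
Definition face_sets : {set {set edge G}} :=
  [set Y : {set edge G} | (Y == finset.set0) || has (fun S => Y \subset edges_of S) T].

Let edge_points_simplex S : S \in T -> edge_points_only S.
Proof.
have [H _ _] := Ttri; move=> /H[vert _ _] p /vert/vertex_of_hull/imfsetP[a _ ->].
by exists a.
Qed.

Let simplex_independent S : S \in T -> affinely_independent S.
Proof. by have [H _ _] := Ttri; move=> /H[]. Qed.

(** Dividing by the degree turns a non-zero class into a point of the polytope. A simplex through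
    this point gives coordinates that become integral after multiplying by the degree again. *)
Lemma face_transversal : transversal (@same_ends G) face_sets.
Proof.
have [_ cover inter] := Ttri.
pose deg (x : {ffun edge G -> nat}) : R := (\sum_a x a)%:R.
have supp0 x : deg x = 0 -> supp x = finset.set0.
  move=> /eqP; rewrite pnatr_eq0 sum_nat_eq0 => /forallP x0.
  by apply/setP => a; rewrite !inE; have := x0 a => /= ->.
pose c (x : {ffun edge G -> nat}) a : R := (x a)%:R / deg x.
have c_ge0 x a : 0 <= c x a by rewrite divr_ge0 ?ler0n.
have c_sum x : deg x != 0 -> \sum_a c x a = 1.
  by move=> x0; rewrite -mulr_suml -natr_sum divff.
have combc x : comb (c x) = (deg x)^-1 *: comb (fun a => (x a)%:R).
  by rewrite -combZ; apply: eq_bigr => a _; rewrite /c mulrC.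
split=> [x|x y xF yF xy].
  have [x0|x0] := eqVneq (deg x) 0.
    by exists x; [rewrite inE supp0 ?eqxx|split].
  have [S ST xS] : exists2 S, S \in T & hull S (comb (c x)).
    by apply/cover; apply: hull_comb => // [a _|]; [exact: in_imfset|exact: c_sum].
  have [d [d0 dS dE]] := hull_combP (edge_points_simplex ST) xS.
  have kdE : comb (fun a => deg x * d a) = comb (fun a => (x a)%:R).
    by rewrite combZ -dE combc scalerA divff // scale1r.
  have kd_int : forall a, deg x * d a \is a Num.int.
    apply: comb_integral => [w wd w0 a|e|v].
    - apply: (@comb_inj _ _ S w (fun=> 0)) => [|||b|].
      + exact: edge_points_simplex.
      + exact: simplex_independent.
      + by move=> b /wd; rewrite mulf_eq0 negb_or => /andP[_ /dS].
      + by rewrite eqxx.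
      + by rewrite w0 /comb big1 // => b _; rewrite scale0r.
    - by rewrite kdE comb_fst; apply: rpred_sum => b _; apply: rpred_nat.
    - by rewrite kdE comb_snd; apply: rpred_sum => b _; apply: rpred_nat.
  pose y : {ffun edge G -> nat} := [ffun a => Num.truncn (deg x * d a)].
  have yE a : (y a)%:R = deg x * d a.
    by rewrite ffunE truncnK // natrEint kd_int mulr_ge0 // ler0n.
  exists y.
    rewrite inE; apply/orP; right; apply/hasP; exists S => //.
    apply/fintype.subsetP => a; rewrite inE => ya; apply: dS.
    by move: ya; rewrite -(eqr_nat R) yE mulf_eq0 negb_or => /andP[].
  apply/(same_ends_comb R); rewrite -kdE.
  by apply: eq_bigr => a _; rewrite yE.
have degxy : deg x = deg y by rewrite /deg (same_ends_sum xy).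
have [x0|x0] := eqVneq (deg x) 0.
  have /setP sx := supp0 x x0; have /setP sy : supp y = finset.set0.
    by apply: supp0; rewrite -degxy.
  apply/ffunP => a; have := sx a; have := sy a; rewrite !inE.
  by move=> /negbFE/eqP -> /negbFE/eqP ->.
have y0 : deg y != 0 by rewrite -degxy.
have face x' : supp x' \in face_sets -> deg x' != 0 ->
    exists2 S, S \in T & forall a, c x' a != 0 -> a \in edges_of S.
  rewrite inE => /orP[/eqP/setP E|/hasP[S ST /fintype.subsetP sub]] x'0.
    case/eqP: x'0; rewrite /deg big1 // => a _.
    by have := E a; rewrite !inE => /negbFE/eqP.
  exists S => // a ca; apply: sub; rewrite inE.
  by apply: contra_neq ca => E; rewrite /c E mul0r.
have [S1 S1T xS1] := face x xF x0; have [S2 S2T yS2] := face y yF y0.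
have cxy : comb (c x) = comb (c y).
  by rewrite !combc degxy; congr (_ *: _); apply/(same_ends_comb R).
have [F [FS1 FS2 FE]] := inter S1 S2 S1T S2T.
have edges_sub S S' : (S `<=` S')%fset -> forall a, a \in edges_of S -> a \in edges_of S'.
  by move=> /fsubsetP sub a; rewrite !inE => /andP[-> /sub].
have hull_c x' S : deg x' != 0 ->
    (forall a, c x' a != 0 -> a \in edges_of S) -> hull S (comb (c x')).
  move=> x'0 cS; apply: hull_comb => // [a /cS|]; last exact: c_sum.
  by rewrite inE => /andP[].
(* The common point has coordinates [d] in the shared face [F]. Independence in [S1] identifies [d]
   with [c x], and independence in [S2] identifies it with [c y]. *)
have zF : hull F (comb (c x)).
  rewrite -FE; split; first exact: hull_c.
  by rewrite cxy; exact: hull_c.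
have FP : edge_points_only F.
  by move=> p /(fsubsetP FS1)/(edge_points_simplex S1T).
have [d [d0 dF dE]] := hull_combP FP zF.
have cxd := comb_inj (edge_points_simplex S1T) (simplex_independent S1T) xS1
  (fun a da => edges_sub _ _ FS1 a (dF a da)) dE.
have cyd := comb_inj (edge_points_simplex S2T) (simplex_independent S2T) yS2
  (fun a da => edges_sub _ _ FS2 a (dF a da)) (etrans (esym cxy) dE).
apply/ffunP => a; apply/eqP; rewrite -(eqr_nat R).
have := cxd a; rewrite -cyd /c degxy => /(mulIf _) -> //.
by rewrite invr_eq0.
Qed.

Lemma card_edges_of S : edge_points_only S -> #|edges_of S| = #|` S|.
Proof.
move=> SE; rewrite -sum1_card -(sum_edges_of (fun=> 1%N) SE).
exact: sum1_size.
Qed.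

Lemma edges_of_points Y : Y \subset @canonical_edges R G ->
  edges_of [fset pt a | a in Y]%fset = Y.
Proof.
move=> /fintype.subsetP YC; apply/setP => a; rewrite inE.
apply/andP/idP => [[aC /imfsetP[b /= bY E]]|aY].
  by rewrite (canonical_edges_inj aC (YC b bY) E).
by split; [exact: YC|exact: in_imfset].
Qed.

Lemma points_edges_of S : edge_points_only S ->
  [fset pt a | a in edges_of S]%fset = S.
Proof.
move=> SE; apply/fsetP => p; apply/imfsetP/idP => [[a /=]|pS].
  by rewrite inE => /andP[_ ?] ->.
have [a aE] := SE p pS; have [b bC bE] := canonical_edge_exists R a.
exists b; last by rewrite bE aE.
by rewrite /= inE bC bE aE.
Qed.

Lemma nb_simplices_face_sets k :
  nb_simplices T k = #|[set Y in face_sets | #|Y| == k.+1]|.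
Proof.
rewrite /nb_simplices cardE -(size_map (fun Y => [fset pt a | a in Y]%fset)).
apply: perm_size; apply: uniq_perm => [||F]; first exact: fset_uniq.
  rewrite map_inj_in_uniq ?enum_uniq // => Y Y'.
  have sub Z : Z \in enum [set Y in face_sets | #|Y| == k.+1] ->
      Z \subset @canonical_edges R G.
    rewrite mem_enum !inE => /andP[/orP[/eqP->|/hasP[S _ ZS]] _]; first exact: finset.sub0set.
    by apply: fintype.subset_trans ZS _; apply/fintype.subsetP => a; rewrite inE => /andP[].
  by move=> /sub YC /sub Y'C E; rewrite -(edges_of_points YC) E edges_of_points.
apply/idP/mapP.
  rewrite !inE /= => /andP[/bigfcupP[S /andP[ST _]]]; rewrite fpowersetE => FS cF.
  have FP : edge_points_only F by move=> p /(fsubsetP FS)/(edge_points_simplex ST).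
  exists (edges_of F); last by rewrite points_edges_of.
  rewrite mem_enum !inE card_edges_of // cF andbT; apply/orP; right.
  apply/hasP; exists S => //; apply/fintype.subsetP => a; rewrite !inE.
  by move=> /andP[-> /(fsubsetP FS)].
move=> [Y]; rewrite mem_enum !inE => /andP[/orP[/eqP->|/hasP[S ST YS]]]; first by rewrite cards0.
move=> cY ->.
have YC : Y \subset @canonical_edges R G.
  by apply: fintype.subset_trans YS _; apply/fintype.subsetP => a; rewrite inE => /andP[].
rewrite -card_edges_of => [|p /imfsetP[a _ ->]]; last by exists a.
rewrite edges_of_points // cY andbT; apply/bigfcupP; exists S; first by rewrite ST.
rewrite fpowersetE; apply/fsubsetP => p /imfsetP[a /= aY ->].
by have /fintype.subsetP/(_ a aY) := YS; rewrite inE => /andP[].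
Qed.

Lemma card_face_sets0 : #|[set Y in face_sets | #|Y| == 0%N]| = 1%N.
Proof.
rewrite -(cards1 (finset.set0 : {set edge G})); apply: eq_card => Y.
by rewrite !inE cards_eq0; case: (Y == finset.set0); rewrite ?andbF.
Qed.

Lemma face_sets_bound Y : Y \in face_sets -> (#|Y| <= (nb_vertices G).-1)%N.
Proof.
rewrite inE => /orP[/eqP->|/hasP[S ST YS]]; first by rewrite cards0.
have [H _ _] := Ttri; have [_ _ <-] := H S ST.
by rewrite -card_edges_of ?subset_leq_card //; exact: edge_points_simplex.
Qed.

End Faces.

(** * From equal counts to the polynomial identity *)

Theorem corollary1p5 (R : realType) (G : bigraph) (M : rotation_system G)
    (Gconn : bigraph_connected G) (Gplane : spherical M)
    (T : {fset {fset ambient R G}}) (Ttri : root_triangulation T)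
    (r0 : vertex (dual M)) (F : fieldType) (u : F) (u_neq0 : u != 0) :
  let s := nb_vertices G in
  let h := map_poly intr (h_poly s.-1 T) in
  let p := map_poly intr (parking_enumerator r0) in
  u ^+ s.-1 * h.[u^-1] = p.[u].
Proof.
move=> s h p; set n := s.-1.
pose N j := #|[set Y in face_sets T | #|Y| == j]|.
have NE j : #|[set Y in dual_spanning r0 | #|Y| == j]| = N j.
  apply: (card_transversal (@same_ends_sym G) (@same_ends_trans G) (@same_ends_sum G)).
    exact: dual_transversal.
  exact: face_transversal.
(* The leading ['X^n] is the term of the empty face, and [k]-dimensional simplices appear at
   [j = k + 1]. *)
have fE : f_poly n T = \sum_(j < n.+1) (N j)%:R *: 'X^(n - j).
  rewrite big_ord_recl /= /N card_face_sets0 scale1r subn0; congr (_ + _).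
  by apply: eq_bigr => k _; rewrite nb_simplices_face_sets.
(* The value of [h] at [u^-1] is that of [f_poly] at [u^-1 - 1], and [u] times this argument is
   [1 - u]. *)
have hE : u ^+ n * h.[u^-1] = \sum_(j < n.+1) (N j)%:R * (u ^+ j * (1 - u) ^+ (n - j)).
  rewrite /h /h_poly fE map_comp_poly horner_comp rmorphB /= map_polyX rmorph1.
  rewrite !hornerE rmorph_sum horner_sum big_distrr /=; apply: eq_bigr => j _.
  rewrite map_polyZ map_polyXn !hornerE /= rmorph_nat [u ^+ n * _]mulrC -!mulrA; congr (_ * _).
  have -> : u ^+ n = u ^+ j * u ^+ (n - j) by rewrite -exprD subnKC // -ltnS.
  by rewrite -mulrA -exprMn mulrBr mulr1 divff.
rewrite hE {hE fE h} /p parking_enumerator_spanning /spanning_sum.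
rewrite (reindex_inj (@finset.setC_inj _)) rmorph_sum horner_sum /=.
(* Equal counts transfer the size bound from faces to the dual family. *)
have bound (Y : {set edge G}) : Y \in dual_spanning r0 -> (#|Y| <= n)%N.
  move=> YF; have : (0 < N #|Y|)%N.
    by rewrite -NE; apply/card_gt0P; exists Y; rewrite inE YF eqxx.
  case/card_gt0P => Y'; rewrite inE => /andP[Y'F /eqP <-]; exact: (face_sets_bound Ttri Y'F).
rewrite (eq_bigl (mem (dual_spanning r0))) => [|Y]; last first.
  by rewrite finset.subsetT [in RHS]inE [in RHS]inE.
rewrite (partition_big (fun Y : {set edge G} => inord #|Y| : 'I_n.+1) xpredT) //=.
apply: eq_bigr => j _.
rewrite (eq_bigl (mem [set Y in dual_spanning r0 | #|Y| == j])) => [|Y]; last first.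
  rewrite !inE; apply: andb_id2l => YF.
  by rewrite -val_eqE /= inordK // ltnS bound // inE.
rewrite (eq_bigr (fun=> u ^+ j * (1 - u) ^+ (n - j))) => [|Y].
  by rewrite sumr_const NE mulr_natl.
move=> /finset.setIdP[_ /eqP cY].
have cYC : #|~: Y| = (#|edge G| - j)%N by rewrite -cY -(cardsC Y) addKn.
have jm : (j <= #|edge G|)%N by rewrite -cY max_card.
have R0 : (0 < #|region M|)%N by apply/card_gt0P; exists r0.
have -> : (#|[set: edge G]| - #|~: Y| = j)%N by rewrite cYC cardsT subKn.
(* Euler's formula says that the number of edges minus that of non-root regions is [n]. *)
have -> : (#|~: Y| - (#|vertex (dual M)| - #|[set r0]|) = n - j)%N.
  rewrite cYC cards1; move: (nat_of_ord j) Gplane R0 => i; rewrite /n /s /spherical /=.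
  by move: #|region M| #|edge G| (nb_vertices G) => a b c; lia.
by rewrite rmorphM !rmorphXn rmorphB rmorph1 /= map_polyX !hornerE.
Qed.
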